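(* Let $L$ be a Lie algebra over a field $\mathbb{F}$ of characteristic $2$, and let $l \in L$ be a non-central idempotent of $L$, i.e. $l \notin Z(L)$ and $(ad_L(l))^2 = ad_L(l)$. Put $L_0 = \{h \in L \mid [l,h] = 0\}$ and $L_1 = \{h \in L \mid [l,h] = h\}$. Then $L = L_0 \oplus L_1$ is a non-degenerate $\mathbb{Z}_2$-grading of $L$.
   Context: For $l \in L$, $ad_L(l) : L \to L$ denotes the map $h \mapsto [l,h]$, and $Z(L)$ denotes the center of $L$. An element $l \in L$ is called an idempotent if $(ad_L(l))^2 = ad_L(l)$ (composition of linear maps). A $\mathbb{Z}_2$-grading of $L$ is a direct sum decomposition of vector spaces $L = L_0 \oplus L_1$ with $[L_a, L_b] \subseteq L_{a+b}$ for all $a,b \in \mathbb{Z}_2$ (indices modulo $2$). It is called degenerate if $L_0 = \{0\}$ or $L_1 = \{0\}$, and non-degenerate otherwise. *)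

(* Defs.v *)
From HB Require Import structures.
From mathcomp Require Import all_boot all_order all_algebra.

Set Implicit Arguments.
Unset Strict Implicit.
Unset Printing Implicit Defensive.

Import GRing.Theory.
Local Open Scope ring_scope.

(* No dimension hypothesis is made. In characteristic 2 the alternating law
   [x, x] = 0 is strictly stronger than antisymmetry. *)
HB.mixin Record Lmodule_isLieAlgebra (F : fieldType) L
    of GRing.Lmodule F L := {
  lie_bracket : {bilinear L -> L -> L};
  lie_alternating : forall x : L, lie_bracket x x = 0;
  lie_jacobi : forall x y z : L,
    lie_bracket x (lie_bracket y z) + lie_bracket y (lie_bracket z x)
      + lie_bracket z (lie_bracket x y) = 0
}.

#[short(type="lieAlgType")]
HB.structure Definition LieAlgebra (F : fieldType) :=
  { L of GRing.Lmodule F L & Lmodule_isLieAlgebra F L }.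

Notation "[ 'lie' x , y ]" := (lie_bracket x y)
  (at level 0, x, y at level 99, format "[ 'lie'  x ,  y ]") : ring_scope.

Section LieTheory.
Variables (F : fieldType) (L : lieAlgType F).

Definition ad (l : L) : L -> L := fun h => [lie l, h].

HB.instance Definition _ (l : L) :=
  GRing.isLinear.Build F L L *:%R (ad l) (linearPr (@lie_bracket F L) l).

Definition lie_central (l : L) : Prop := forall h : L, [lie l, h] = 0.

Definition lie_idempotent (l : L) : Prop := ad l \o ad l =1 ad l.

(* The two subspaces are indexed by the ring 'Z_2, whose addition is the
   addition modulo 2 of the degrees. *)
Definition Z2_family (L0 L1 : {pred L}) : 'Z_2 -> {pred L} :=
  fun a => if a == 0 then L0 else L1.

Definition direct_sum_decomposition (G : 'Z_2 -> {pred L}) : Prop :=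
  [/\ forall a, submod_closed (G a),
      forall h : L, exists h0 h1 : L,
        [/\ h0 \in G 0, h1 \in G 1 & h = h0 + h1]
    & forall h : L, h \in G 0 -> h \in G 1 -> h = 0].

Definition Z2_grading (G : 'Z_2 -> {pred L}) : Prop :=
  direct_sum_decomposition G /\
  (forall (a b : 'Z_2) (x y : L),
     x \in G a -> y \in G b -> [lie x, y] \in G (a + b)).

Definition Z2_degenerate (G : 'Z_2 -> {pred L}) : Prop :=
  G 0 =i pred1 0 \/ G 1 =i pred1 0.

End LieTheory.

(* Main.v *)
(** In characteristic 2 the degree-[a] component is the eigenspace of [ad l] for
    the image of [a] in the prime field, and eigenvalues add under the bracket
    because [ad l] is a derivation.  Since [ad l] is idempotent,
    [h = (h + ad l h) + ad l h] is the decomposition of [h].  Non-degeneracy: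
    [l] is a nonzero element of degree 0, and every nonzero [ad l h] has
    degree 1. *)

Require Import Defs.
From mathcomp Require Import all_boot all_order all_algebra.

Set Implicit Arguments.
Unset Strict Implicit.
Unset Printing Implicit Defensive.

Import GRing.Theory.
Local Open Scope ring_scope.

(** Polarization of the alternating law at [x + y]. *)
Lemma lie_antisym (F : fieldType) (L : lieAlgType F) (x y : L) :
  [lie x, y] = - [lie y, x].
Proof.
apply/eqP; rewrite -addr_eq0; apply/eqP.
have := lie_alternating (x + y).
by rewrite linearDl !linearDr /= !lie_alternating add0r addr0.
Qed.

Lemma ad_derivation (F : fieldType) (L : lieAlgType F) (l x y : L) :
  [lie l, [lie x, y]] = [lie [lie l, x], y] + [lie x, [lie l, y]].
Proof.
have /eqP := lie_jacobi l x y.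
rewrite -addrA addr_eq0 opprD => /eqP ->.
by rewrite (lie_antisym y l) linearNr opprK -lie_antisym addrC.
Qed.

Lemma ad_eigen_lie (F : fieldType) (L : lieAlgType F) (l x y : L) (a b : F) :
    [lie l, x] = a *: x -> [lie l, y] = b *: y ->
  [lie l, [lie x, y]] = (a + b) *: [lie x, y].
Proof.
by move=> lx ly; rewrite ad_derivation lx ly linearZl linearZr scalerDl.
Qed.

Lemma pchar2_addvv (F : fieldType) (V : lmodType F) (v : V) :
  2%N \in [pchar F] -> v + v = 0.
Proof. by move=> char2; rewrite -[v]scale1r -scalerDl addrr_pchar2 ?scale0r. Qed.

Theorem theorem2p2 (F : fieldType) (L : lieAlgType F) (l : L)
    (char2 : 2%N \in [pchar F])
    (l_noncentral : ~ lie_central l)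
    (l_idempotent : lie_idempotent l) :
  let L0 : {pred L} := [pred h : L | [lie l, h] == 0] in
  let L1 : {pred L} := [pred h : L | [lie l, h] == h] in
  Z2_grading (Z2_family L0 L1) /\ ~ Z2_degenerate (Z2_family L0 L1).
Proof.
move=> L0 L1; set G := Z2_family L0 L1.
(* A single eigenvalue equation covers both degrees, so closure and bracket compatibility need no
   case split on degrees. *)
have GE a h : (h \in G a) = ([lie l, h] == (a : nat)%:R *: h).
  by case: a => [[|[|//]] a2]; rewrite ?scale0r ?scale1r.
have G0E h : (h \in G 0) = ([lie l, h] == 0) by [].
have G1E h : (h \in G 1) = ([lie l, h] == h) by [].
(* Idempotence says exactly that the image of [ad l] lies in degree 1. *)
have adG1 h : [lie l, h] \in G 1 by rewrite G1E; apply/eqP/l_idempotent.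
split; [split; [split|]|].
- move=> a; split; first by rewrite GE linear0r scaler0.
  move=> c x y; rewrite !GE => /eqP lx /eqP ly.
  by rewrite linearPr /= lx ly scalerDr !scalerA mulrC.
- move=> h; exists (h + [lie l, h]), [lie l, h]; split=> //.
    (* [ad l] sends [h + [lie l, h]] to twice [[lie l, h]]. *)
    by rewrite G0E linearDr (eqP (adG1 h)) pchar2_addvv.
  by rewrite -addrA pchar2_addvv ?addr0.
- by move=> h; rewrite G0E G1E => /eqP -> /eqP.
- move=> a b x y; rewrite !GE => /eqP lx /eqP ly.
  rewrite (ad_eigen_lie lx ly) -natrD /=.
  (* Addition in ['Z_2] reduces the sum of representatives modulo 2, which does not change its image
     in [F]. *)
  by rewrite -[in X in X == _](GRing.natr_mod_pchar char2).
- case=> degG; apply: l_noncentral => h.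
    have: l \in G 0 by rewrite G0E lie_alternating.
    by rewrite degG => /eqP ->; rewrite linear0l.
  by have := adG1 h; rewrite degG => /eqP.
Qed.
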